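(* Let $k\in\{3,4\}$ and let $p$ be a real number with $2k<p<2k+2$. Then the three-term idempotent polynomial $P_k:=1+e_1+e_{k+2}$ has smaller $p$-norm than $Q_k:=1+e_1-e_{k+2}$, that is, $$\|P_k\|_p<\|Q_k\|_p .$$
   Context: $\mathbb T=\mathbb R/\mathbb Z$ is the one-dimensional torus, $e_n(x):=e^{2\pi i n x}$ for $n\in\mathbb Z$, and $\|f\|_p:=\left(\int_0^1|f(x)|^p\,dx\right)^{1/p}$. *)

(* Defs.v *)
From Stdlib Require Import Reals Lra ZArith.
From Coquelicot Require Import Coquelicot.
Open Scope R_scope.

Definition Cexp (z : C) : C := (RtoC (exp (Re z)) * (cos (Im z), sin (Im z)))%C.

(* Functions on the torus R/Z are represented by 1-periodic functions on R. *)
Definition e (n : Z) (x : R) : C :=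
  Cexp (RtoC (2 * PI) * Ci * RtoC (IZR n) * RtoC x)%C.

(* [x ^ y] for [0 <= x] and [0 < y]; [Rpower] alone is wrong at [x = 0], since
   [ln 0 = 0] makes [Rpower 0 y = 1]. *)
Definition rpow (x y : R) : R :=
  if Req_EM_T x 0 then 0 else Rpower x y.

(* [RInt] is a total function: the integral exists when [f] is continuous
   ([ex_RInt_rpow_Cmod]), in particular for [P k] and [Q k]. *)
Definition pnorm (p : R) (f : R -> C) : R :=
  rpow (RInt (fun x => rpow (Cmod (f x)) p) 0 1) (/ p).

Definition P (k : Z) (x : R) : C := (1 + e 1 x + e (k + 2) x)%C.

Definition Q (k : Z) (x : R) : C := (1 + e 1 x - e (k + 2) x)%C.

Lemma continuous_rpow (p x : R) : 0 < p -> 0 <= x ->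
  filterlim (fun y => rpow y p) (within (fun y => 0 <= y) (locally x))
    (locally (rpow x p)).
Proof.
intros Hp [Hx | <-].
- apply (filterlim_filter_le_1 (F := locally x)); [apply filter_le_within |].
  replace (rpow x p) with (Rpower x p)
    by (unfold rpow; destruct (Req_EM_T x 0); [lra | reflexivity]).
  apply filterlim_ext_loc with (fun y => Rpower y p).
  + exists (mkposreal x Hx); intros y Hy; apply Rabs_def2 in Hy;
      cbn in Hy; unfold minus, plus, opp in Hy; cbn in Hy.
    unfold rpow; destruct (Req_EM_T y 0); [lra | reflexivity].
  + apply (ex_derive_continuous (fun y => Rpower y p)).
    unfold Rpower; auto_derive; exact Hx.
- unfold rpow at 2; destruct (Req_EM_T 0 0) as [_ | H]; [| lra].
  apply filterlim_locally; intros eps.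
  exists (mkposreal (Rpower eps (/ p)) (exp_pos _)).
  intros y Hy Hy0; apply Rabs_def2 in Hy;
    cbn in Hy; unfold minus, plus, opp in Hy; cbn in Hy.
  apply Rabs_def1; unfold minus, plus, opp, rpow; cbn;
    destruct (Req_EM_T y 0) as [Ey | Ey];
    pose proof (cond_pos eps); try lra.
  + enough (Rpower y p < eps) by lra.
    replace (pos eps) with (Rpower (Rpower eps (/ p)) p).
    * apply Rlt_Rpower_l; lra.
    * rewrite Rpower_mult, Rinv_l by lra; apply Rpower_1, cond_pos.
  + pose proof (exp_pos (p * ln y)); unfold Rpower; lra.
Qed.

Lemma ex_RInt_rpow_Cmod (p a b : R) (f : R -> C) : 0 < p ->
  (forall x, continuous (fun t => Re (f t)) x) ->
  (forall x, continuous (fun t => Im (f t)) x) ->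
  ex_RInt (fun x => rpow (Cmod (f x)) p) a b.
Proof.
intros Hp HRe HIm; apply (ex_RInt_continuous (V := R_CompleteNormedModule)).
intros x _.
assert (Hc : continuous (fun t => Cmod (f t)) x).
{ unfold Cmod; apply (continuous_comp _ sqrt).
  - apply (continuous_plus (fun t => fst (f t) ^ 2) (fun t => snd (f t) ^ 2)).
    + apply (continuous_comp (fun t => fst (f t)) (fun s => s ^ 2)); [apply HRe |].
      apply (ex_derive_continuous (fun s : R => s ^ 2)); auto_derive; exact I.
    + apply (continuous_comp (fun t => snd (f t)) (fun s => s ^ 2)); [apply HIm |].
      apply (ex_derive_continuous (fun s : R => s ^ 2)); auto_derive; exact I.
  - apply continuous_sqrt. }
apply (filterlim_comp _ _ _ (fun t => Cmod (f t)) (fun y => rpow y p) _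
  (within (fun y => 0 <= y) (locally (Cmod (f x))))).
- intros S HS; destruct (Hc _ HS) as [d Hd]; exists d.
  intros y Hy; apply (Hd y Hy), Cmod_ge_0.
- apply continuous_rpow; [exact Hp | apply Cmod_ge_0].
Qed.

Lemma e_cos_sin (n : Z) (x : R) :
  e n x = (cos (2 * PI * IZR n * x), sin (2 * PI * IZR n * x)).
Proof.
unfold e, Cexp.
replace (RtoC (2 * PI) * Ci * RtoC (IZR n) * RtoC x)%C
  with ((0, 2 * PI * IZR n * x) : C)
  by (apply injective_projections; cbn; ring).
cbn; rewrite exp_0; apply injective_projections; cbn; ring.
Qed.

Lemma ex_RInt_P (p : R) (k : Z) : 0 < p ->
  ex_RInt (fun x => rpow (Cmod (P k x)) p) 0 1.
Proof.
intros Hp; apply ex_RInt_rpow_Cmod; [exact Hp | |]; intros x;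
  [ apply continuous_ext with (fun t =>
      1 + cos (2 * PI * IZR 1 * t) + cos (2 * PI * IZR (k + 2) * t))
  | apply continuous_ext with (fun t =>
      0 + sin (2 * PI * IZR 1 * t) + sin (2 * PI * IZR (k + 2) * t)) ];
  try (intros t; unfold P; rewrite !e_cos_sin; reflexivity);
  apply (ex_derive_continuous (V := R_NormedModule)); auto_derive; exact I.
Qed.

Lemma ex_RInt_Q (p : R) (k : Z) : 0 < p ->
  ex_RInt (fun x => rpow (Cmod (Q k x)) p) 0 1.
Proof.
intros Hp; apply ex_RInt_rpow_Cmod; [exact Hp | |]; intros x;
  [ apply continuous_ext with (fun t =>
      1 + cos (2 * PI * IZR 1 * t) - cos (2 * PI * IZR (k + 2) * t))
  | apply continuous_ext with (fun t =>
      0 + sin (2 * PI * IZR 1 * t) - sin (2 * PI * IZR (k + 2) * t)) ];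
  try (intros t; unfold Q; rewrite !e_cos_sin; reflexivity);
  apply (ex_derive_continuous (V := R_NormedModule)); auto_derive; exact I.
Qed.

(* Main.v *)
Require Import Defs.
From Stdlib Require Import Reals ZArith.
From Coquelicot Require Import Coquelicot.
From Stdlib Require Import List Lra Lia.
Open Scope R_scope.

(** Put [s = p/2] and [t = 1 - |f|^2/9], which lies in [0, 1] for [f = P k] and [f = Q k],
    so that [|f|^p = 9^s (1 - t)^s].  In the binomial expansion of [(1 - t)^s] every
    remainder has the sign of the first omitted coefficient [b_M] and is largest at [t = 1],
    where it equals [b_M M / s].  The moments of [t] are [9^-m] times integers, and those of
    [P k] and [Q k] agree for [m < k + 2], because the even norms agree.  For [k < s < k + 1]
    the coefficients [b_m] with [m >= k + 2] all have one sign, so after division by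
    [b_(k+2)] it remains to bound a finite sum of integers with weights
    [b_m / b_(k+2)] that are products of the ratios [(i - s)/(i + 1)]; 40 terms suffice for
    [k = 3] and 46 for [k = 4]. *)

(** * The binomial series of [(1 - t) ^ s] *)

(** This is [(-1)^m binom(s, m)], the coefficient of [t^m] in [(1 - t)^s]. Defining it by successive
    ratios makes sign arguments and the Horner scheme inductive. *)
Fixpoint bincoef (s : R) (m : nat) : R :=
  match m with
  | O => 1
  | S n => bincoef s n * (INR n - s) / (INR n + 1)
  end.

Fixpoint binpoly (s : R) (M : nat) (t : R) : R :=
  match M with
  | O => 0
  | S n => binpoly s n t + bincoef s n * t ^ n
  end.

(** Coefficientwise form of the derivative rule [((1 - t)^s)' = -s (1 - t)^(s-1)]. *)
Lemma bincoef_shift (s : R) (m : nat) :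
  (INR m + 1) * bincoef s (S m) = - s * bincoef (s - 1) m.
Proof.
induction m as [|m IH]; [simpl; field |].
change (bincoef s (S (S m)))
  with (bincoef s (S m) * (INR (S m) - s) / (INR (S m) + 1)).
change (bincoef (s - 1) (S m))
  with (bincoef (s - 1) m * (INR m - (s - 1)) / (INR m + 1)).
rewrite S_INR; pose proof (pos_INR m).
replace (- s * (bincoef (s - 1) m * (INR m - (s - 1)) / (INR m + 1)))
  with ((- s * bincoef (s - 1) m) * (INR m - (s - 1)) / (INR m + 1)) by (field; lra).
rewrite <- IH; field; lra.
Qed.

Lemma binpoly_0 (s : R) (M : nat) : binpoly s (S M) 0 = 1.
Proof.
induction M as [|M IH]; [simpl; ring |].
change (binpoly s (S M) 0 + bincoef s (S M) * 0 ^ S M = 1).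
rewrite IH; simpl; ring.
Qed.

(** The partial sums of the coefficients have a closed form. Since [(1 - t)^s] vanishes at [t = 1]
    for [s > 0], this gives the exact remainder there. *)
Lemma binpoly_1 (s : R) (M : nat) : s * binpoly s M 1 = - (INR M * bincoef s M).
Proof.
induction M as [|M IH]; [simpl; ring |].
change (s * (binpoly s M 1 + bincoef s M * 1 ^ M)
  = - (INR (S M) * (bincoef s M * (INR M - s) / (INR M + 1)))).
rewrite pow1, Rmult_plus_distr_l, IH, S_INR; pose proof (pos_INR M); field; lra.
Qed.

Lemma is_derive_binpoly (s : R) (M : nat) (t : R) :
  is_derive (binpoly s (S M)) t (- s * binpoly (s - 1) M t).
Proof.
induction M as [|M IH].
- apply is_derive_ext with (fun _ => 1); [intros; simpl; ring |].
  simpl; replace (- s * 0) with 0 by ring; apply (is_derive_const (V := R_NormedModule)).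
- apply is_derive_ext with
    (fun t => plus (binpoly s (S M) t) (bincoef s (S M) * t ^ S M)); [reflexivity |].
  replace (- s * binpoly (s - 1) (S M) t) with
    (plus (- s * binpoly (s - 1) M t) ((INR M + 1) * bincoef s (S M) * t ^ M)).
  + apply (is_derive_plus (V := R_NormedModule)); [exact IH |].
    rewrite <- S_INR; auto_derive; [exact I | simpl; ring].
  + rewrite bincoef_shift; unfold plus; simpl; ring.
Qed.

Definition binrem (s : R) (M : nat) (t : R) : R := Rpower (1 - t) s - binpoly s M t.

Lemma binrem_0 (s : R) (M : nat) : binrem s (S M) 0 = 0.
Proof.
unfold binrem; rewrite binpoly_0, Rminus_0_r; unfold Rpower; rewrite ln_1, Rmult_0_r, exp_0; ring.
Qed.

Lemma is_derive_binrem (s : R) (M : nat) (t : R) : t < 1 ->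
  is_derive (binrem s (S M)) t (- s * binrem (s - 1) M t).
Proof.
intros Ht; unfold binrem.
replace (- s * (Rpower (1 - t) (s - 1) - binpoly (s - 1) M t))
  with (minus (- s * Rpower (1 - t) (s - 1)) (- s * binpoly (s - 1) M t))
  by (unfold minus, plus, opp; simpl; ring).
apply (is_derive_minus (V := R_NormedModule)); [| apply is_derive_binpoly].
replace (Rpower (1 - t) (s - 1)) with (Rpower (1 - t) s / (1 - t))
  by (replace (s - 1) with (s + - (1)) by ring;
      rewrite Rpower_plus, Rpower_Ropp, Rpower_1 by lra; reflexivity).
unfold Rpower; auto_derive; [lra | unfold Rminus; field; lra].
Qed.

(** By the mean value theorem and [bincoef_shift], the increment is [s^2 (y - x) / (M + 1)] times a
    value of the product for [s - 1] and [M]. Monotonicity gives the sign of the remainder by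
    comparison with [t = 0] and its size by comparison with [t] tending to 1. *)
Lemma bincoef_binrem_incr (s : R) (M : nat) (x y : R) :
  (forall t, 0 <= t < 1 -> 0 <= bincoef (s - 1) M * binrem (s - 1) M t) ->
  0 <= x <= y -> y < 1 ->
  bincoef s (S M) * binrem s (S M) x <= bincoef s (S M) * binrem s (S M) y.
Proof.
intros IH Hx Hy.
destruct (MVT_gen (binrem s (S M)) x y (fun c => - s * binrem (s - 1) M c))
  as [c [Hc E]].
- intros u; rewrite Rmin_left, Rmax_right by lra; intros; apply is_derive_binrem; lra.
- intros u; rewrite Rmin_left, Rmax_right by lra; intros.
  apply continuity_pt_filterlim.
  apply (ex_derive_continuous (V := R_NormedModule)); eexists; apply is_derive_binrem; lra.
- rewrite Rmin_left, Rmax_right in Hc by lra.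
  apply Rminus_le_0; rewrite <- Rmult_minus_distr_l, E.
  pose proof (pos_INR M).
  replace (bincoef s (S M)) with (- s * bincoef (s - 1) M / (INR M + 1))
    by (rewrite <- bincoef_shift; field; lra).
  replace (_ * _)
    with (s ^ 2 * (bincoef (s - 1) M * binrem (s - 1) M c) * (y - x) / (INR M + 1))
    by (field; lra).
  apply Rdiv_le_0_compat; [| lra].
  apply Rmult_le_pos; [| lra].
  apply Rmult_le_pos; [apply pow2_ge_0 | apply IH; lra].
Qed.

(* Both the remainder and the next coefficient pick up the factor [-s] under
   differentiation, so their product has a sign that does not depend on [s]. *)
Lemma bincoef_binrem_ge0 (s : R) (M : nat) (t : R) : 0 <= t < 1 ->
  0 <= bincoef s M * binrem s M t.
Proof.
revert s t; induction M as [|M IH]; intros s t Ht.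
- unfold binrem; simpl; pose proof (exp_pos (s * ln (1 - t))); unfold Rpower; lra.
- rewrite <- (Rmult_0_r (bincoef s (S M))), <- (binrem_0 s M) at 1.
  apply bincoef_binrem_incr; [apply IH | lra | lra].
Qed.

Lemma rpow_pos_eq (x y : R) : 0 < x -> rpow x y = Rpower x y.
Proof. intros Hx; unfold rpow; destruct (Req_EM_T x 0); [lra | reflexivity]. Qed.

Lemma rpow_0 (y : R) : rpow 0 y = 0.
Proof. unfold rpow; destruct (Req_EM_T 0 0); [reflexivity | lra]. Qed.

Lemma binrem_at_1 (s : R) (M : nat) : 0 < s ->
  0 - binpoly s M 1 = bincoef s M * INR M / s.
Proof.
intros Hs; pose proof (binpoly_1 s M) as E.
apply Rmult_eq_reg_l with s; [| lra].
rewrite Rmult_minus_distr_l, E; field; lra.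
Qed.

Lemma binpoly_remainder (s : R) (M : nat) (t : R) : 0 < s -> 0 <= t <= 1 ->
  0 <= bincoef s (S M) * (rpow (1 - t) s - binpoly s (S M) t)
    <= bincoef s (S M) ^ 2 * INR (S M) / s.
Proof.
intros Hs Ht.
assert (E1 : bincoef s (S M) * (0 - binpoly s (S M) 1)
  = bincoef s (S M) ^ 2 * INR (S M) / s) by (rewrite binrem_at_1 by lra; field; lra).
(* At [t = 1] the power is [rpow 0 s = 0], which [Rpower] does not give, so this endpoint is
   separate. *)
destruct (Req_dec t 1) as [-> | Ht1].
- rewrite Rminus_diag, rpow_0, E1; split; [| lra].
  apply Rdiv_le_0_compat; [| lra].
  apply Rmult_le_pos; [apply pow2_ge_0 | apply pos_INR].
- rewrite rpow_pos_eq by lra; split; [apply bincoef_binrem_ge0; lra |].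
  rewrite <- E1.
  change (Rbar_le (bincoef s (S M) * binrem s (S M) t)
    (bincoef s (S M) * (0 - binpoly s (S M) 1))).
  (* For the upper bound, [t] is compared with [y] in [(t, 1)], and then [y] tends to 1 from the
     left. *)
  apply (filterlim_le (F := at_left 1)
    (fun _ => bincoef s (S M) * binrem s (S M) t)
    (fun y => bincoef s (S M) * (rpow (1 - y) s - binpoly s (S M) y))).
  + assert (Hd : 0 < 1 - t) by lra.
    exists (mkposreal _ Hd); intros y Hy Hy1; apply Rabs_def2 in Hy;
      cbn in Hy; unfold minus, plus, opp in Hy; cbn in Hy.
    rewrite rpow_pos_eq by lra.
    apply bincoef_binrem_incr; [intros; apply bincoef_binrem_ge0 | |]; lra.
  + apply filterlim_const.
  + apply (filterlim_comp _ _ _ (fun y => rpow (1 - y) s - binpoly s (S M) y)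
      (fun z => bincoef s (S M) * z) _ (locally (0 - binpoly s (S M) 1))).
    * apply (filterlim_comp_2 (G := locally 0) (H := locally (- binpoly s (S M) 1))
        (fun y => rpow (1 - y) s) (fun y => - binpoly s (S M) y) Rplus).
      (* [rpow] is continuous at 0 only from the right, so [1 - y >= 0] must be kept in the
         filter. *)
      -- apply (filterlim_comp _ _ _ (fun y => 1 - y) (fun z => rpow z s) _
           (within (fun y => 0 <= y) (locally 0))).
         ++ intros S [d Hd]; exists d; intros y Hy Hy1; apply Hd; [| lra].
            apply Rabs_def2 in Hy; apply Rabs_def1;
              cbn in *; unfold minus, plus, opp in *; cbn in *; lra.
         ++ rewrite <- (rpow_0 s) at 2; apply continuous_rpow; lra.
      -- apply (filterlim_filter_le_1 (F := locally 1)); [apply filter_le_within |].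
         apply (continuous_opp (V := R_NormedModule)).
         apply (ex_derive_continuous (V := R_NormedModule)).
         eexists; apply is_derive_binpoly.
      -- apply (filterlim_plus (V := R_NormedModule)).
    * apply (filterlim_scal_r (V := R_NormedModule)).
Qed.

(** * Moments of trigonometric polynomials *)

(* [cosum l n] is the real part of the Laurent polynomial [sum_i l_i z^(n+i)]
   at [z = exp (2 i PI x)]. *)
Fixpoint cosum (l : list Z) (n : Z) (x : R) : R :=
  match l with
  | nil => 0
  | a :: l' => IZR a * cos (2 * PI * IZR n * x) + cosum l' (n + 1) x
  end.

Fixpoint const_coef (l : list Z) (n : Z) : Z :=
  match l with
  | nil => 0
  | a :: l' => ((if n =? 0 then a else 0) + const_coef l' (n + 1))%Z
  end.

Fixpoint ladd (l l' : list Z) : list Z :=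
  match l, l' with
  | nil, _ => l'
  | _, nil => l
  | a :: r, a' :: r' => (a + a')%Z :: ladd r r'
  end.

Definition lscale (c : Z) (l : list Z) : list Z := map (Z.mul c) l.

Definition lshift (i : nat) (l : list Z) : list Z := repeat 0%Z i ++ l.

Lemma cosum_ladd (l l' : list Z) (n : Z) (x : R) :
  cosum (ladd l l') n x = cosum l n x + cosum l' n x.
Proof.
revert l' n; induction l as [|a l IH]; intros [|a' l'] n; simpl; try ring.
rewrite IH, plus_IZR; ring.
Qed.

Lemma cosum_lscale (c : Z) (l : list Z) (n : Z) (x : R) :
  cosum (lscale c l) n x = IZR c * cosum l n x.
Proof.
revert n; induction l as [|a l IH]; intros n; simpl; [ring |].
unfold lscale in IH; rewrite IH, mult_IZR; ring.
Qed.

Lemma cosum_lshift (i : nat) (l : list Z) (n : Z) (x : R) :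
  cosum (lshift i l) n x = cosum l (n + Z.of_nat i) x.
Proof.
revert n; induction i as [|i IH]; intros n.
- simpl; f_equal; lia.
- change (lshift (S i) l) with (0%Z :: lshift i l).
  cbn [cosum]; rewrite IH, Rmult_0_l, Rplus_0_l; f_equal; lia.
Qed.

Lemma cosum_mul_cos (l : list Z) (n j : Z) (x : R) :
  2 * cos (2 * PI * IZR j * x) * cosum l n x = cosum l (n + j) x + cosum l (n - j) x.
Proof.
revert n; induction l as [|a l IH]; intros n; cbn [cosum]; [ring |].
rewrite Rmult_plus_distr_l, IH, plus_IZR, minus_IZR.
replace (n + j + 1)%Z with (n + 1 + j)%Z by ring.
replace (n - j + 1)%Z with (n + 1 - j)%Z by ring.
replace (2 * PI * (IZR n + IZR j) * x) with (2 * PI * IZR n * x + 2 * PI * IZR j * x) by ring.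
replace (2 * PI * (IZR n - IZR j) * x) with (2 * PI * IZR n * x - 2 * PI * IZR j * x) by ring.
rewrite cos_plus, cos_minus; ring.
Qed.

Lemma is_RInt_cos (n : Z) :
  is_RInt (fun x => cos (2 * PI * IZR n * x)) 0 1 (if (n =? 0)%Z then 1 else 0).
Proof.
destruct (Z.eqb_spec n 0) as [-> | Hn].
- apply is_RInt_ext with (fun _ => 1).
  + intros x _; rewrite Rmult_0_r, Rmult_0_l, cos_0; reflexivity.
  + replace 1 with (scal (1 - 0) 1) at 2 by (unfold scal; simpl; unfold mult; simpl; ring).
    apply (is_RInt_const (V := R_NormedModule)).
- pose proof PI_neq0 as Hpi; apply not_0_IZR in Hn.
  assert (H1 : sin (2 * PI * IZR n * 1) = 0).
  { apply sin_eq_0_1; exists (2 * n)%Z; rewrite mult_IZR; ring. }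
  set (F := fun x => sin (2 * PI * IZR n * x) / (2 * PI * IZR n)).
  replace 0 with (minus (F 1) (F 0)) at 2
    by (unfold F, minus, plus, opp; simpl; rewrite H1, Rmult_0_r, sin_0; field; split; assumption).
  apply (is_RInt_derive (V := R_CompleteNormedModule) F); intros x _.
  + unfold F; auto_derive; [exact I | field; split; assumption].
  + apply (ex_derive_continuous (V := R_NormedModule)); auto_derive; exact I.
Qed.

Lemma is_RInt_cosum (l : list Z) (n : Z) :
  is_RInt (cosum l n) 0 1 (IZR (const_coef l n)).
Proof.
revert n; induction l as [|a l IH]; intros n.
- simpl; replace 0 with (scal (1 - 0) 0) at 2
    by (unfold scal; simpl; unfold mult; simpl; ring).
  apply (is_RInt_const (V := R_NormedModule)).
- replace (IZR (const_coef (a :: l) n))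
    with (plus (scal (IZR a) (if (n =? 0)%Z then 1 else 0)) (IZR (const_coef l (n + 1)))).
  + apply (is_RInt_plus (V := R_NormedModule)); [| apply IH].
    apply (is_RInt_scal (V := R_NormedModule)), is_RInt_cos.
  + cbn [const_coef]; rewrite plus_IZR; unfold plus, scal; simpl; unfold mult; simpl.
    destruct (n =? 0)%Z; ring.
Qed.

(* [sqmod 1 k] and [sqmod (-1) k] are [|P k|^2] and [|Q k|^2]. *)
Definition sqmod (eps k : Z) (x : R) : R :=
  3 + 2 * cos (2 * PI * IZR 1 * x)
  + IZR eps * (2 * cos (2 * PI * IZR (k + 1) * x) + 2 * cos (2 * PI * IZR (k + 2) * x)).

(* Multiplies by [9 - sqmod eps k], up to the factor [z^(k+2)]. *)
Definition comod_mul (eps : Z) (k : nat) (l : list Z) : list Z :=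
  ladd (lscale 6 (lshift (k + 2) l))
    (ladd (lscale (-1) (ladd (lshift (k + 1) l) (lshift (k + 3) l)))
      (lscale (- eps)
        (ladd (ladd l (lshift 1 l)) (ladd (lshift (2 * k + 3) l) (lshift (2 * k + 4) l))))).

Lemma cosum_comod_mul (eps : Z) (k : nat) (l : list Z) (n : Z) (x : R) :
  cosum (comod_mul eps k l) (n - (Z.of_nat k + 2)) x
  = (9 - sqmod eps (Z.of_nat k) x) * cosum l n x.
Proof.
pose proof (cosum_mul_cos l n 1 x) as E1.
pose proof (cosum_mul_cos l n (Z.of_nat k + 1) x) as E2.
pose proof (cosum_mul_cos l n (Z.of_nat k + 2) x) as E3.
set (u1 := cos (2 * PI * IZR 1 * x)) in *.
set (u2 := cos (2 * PI * IZR (Z.of_nat k + 1) * x)) in *.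
set (u3 := cos (2 * PI * IZR (Z.of_nat k + 2) * x)) in *.
transitivity (6 * cosum l n x - 2 * u1 * cosum l n x
  - IZR eps * (2 * u2 * cosum l n x + 2 * u3 * cosum l n x));
  [| unfold sqmod; fold u1 u2 u3; ring].
rewrite E1, E2, E3; unfold comod_mul.
repeat (rewrite cosum_ladd || rewrite cosum_lscale || rewrite cosum_lshift).
rewrite opp_IZR.
replace (n - (Z.of_nat k + 2) + Z.of_nat (k + 2))%Z with n by lia.
replace (n - (Z.of_nat k + 2) + Z.of_nat (k + 1))%Z with (n - 1)%Z by lia.
replace (n - (Z.of_nat k + 2) + Z.of_nat (k + 3))%Z with (n + 1)%Z by lia.
replace (n - (Z.of_nat k + 2) + Z.of_nat 1)%Z with (n - (Z.of_nat k + 1))%Z by lia.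
replace (n - (Z.of_nat k + 2) + Z.of_nat (2 * k + 3))%Z with (n + (Z.of_nat k + 1))%Z by lia.
replace (n - (Z.of_nat k + 2) + Z.of_nat (2 * k + 4))%Z with (n + (Z.of_nat k + 2))%Z by lia.
ring.
Qed.

(** * The moment certificate *)

(** Started from the constant 1, the lists at step [m] hold the Laurent coefficients of
    [(9 - sqmod)^m] for [eps] and [- eps], with lowest exponent [off]. The entries are thus [9^m]
    times the differences of the [m]-th moments of [t]. *)
Fixpoint moment_diffs (eps : Z) (k n : nat) (l l' : list Z) (off : Z) : list Z :=
  match n with
  | O => nil
  | S n' => (const_coef l off - const_coef l' off)%Z
      :: moment_diffs eps k n' (comod_mul eps k l) (comod_mul (- eps) k l')
           (off - (Z.of_nat k + 2))
  end.

(* With [c_i = b_(k+2) b_i > 0], so that [c_(i+1) / c_i = (i - s) / (i + 1)], this is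
   a Horner lower bound, valid for all [k < s < k + 1], of
   [9^j / c_j (sum_i c_(j+i) l_i / 9^(j+i) - c_M M / s)] with [M = j + length l];
   rounding down costs less than one unit per step. *)
Fixpoint horner_low (k j : Z) (l : list Z) : Z :=
  match l with
  | nil => (- (9 ^ j * j) / k)%Z
  | z :: l' =>
      let L := horner_low k (j + 1) l' in
      (z + L * (j - k - (if 0 <=? L then 1 else 0)) / (9 * (j + 1)))%Z
  end.

Definition certificate (eps : Z) (k M : nat) : bool :=
  let l := moment_diffs eps k M (1 :: nil)%Z (1 :: nil)%Z 0 in
  forallb (Z.eqb 0) (firstn (k + 2) l)
  && (0 <? horner_low (Z.of_nat k) (Z.of_nat (k + 2)) (skipn (k + 2) l))%Z.

(** Here and in [certificate_4] the choice [eps = (-1)^k] makes the first nonzero moment difference,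
    at index [k + 2], positive; it equals [4 (k + 2)]. *)
Lemma certificate_3 : certificate (-1) 3 40 = true.
Proof. vm_compute; reflexivity. Qed.

Lemma certificate_4 : certificate 1 4 46 = true.
Proof. vm_compute; reflexivity. Qed.

Lemma IZR_div_le (a b : Z) : (0 < b)%Z -> IZR (a / b) <= IZR a / IZR b.
Proof.
intros Hb; apply Rle_div_r; [apply IZR_lt; exact Hb |].
rewrite <- mult_IZR; apply IZR_le; pose proof (Z.mul_div_le a b Hb); lia.
Qed.

(** Once the index exceeds [s], every ratio [(i - s)/(i + 1)] is positive, so the sign no longer
    changes. *)
Lemma bincoef_sign_past (s : R) (m i : nat) :
  s < INR m -> bincoef s m <> 0 -> 0 < bincoef s m * bincoef s (m + i).
Proof.
intros Hs Hb; induction i as [|i IH].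
- rewrite Nat.add_0_r; pose proof (Rsqr_pos_lt _ Hb); unfold Rsqr in *; lra.
- rewrite Nat.add_succ_r; cbn [bincoef].
  rewrite plus_INR; pose proof (pos_INR i); pose proof (pos_INR m).
  replace (bincoef s m * _)
    with (bincoef s m * bincoef s (m + i) * ((INR m + INR i - s) / (INR m + INR i + 1)))
    by (field; lra).
  apply Rmult_lt_0_compat; [exact IH | apply Rdiv_lt_0_compat; lra].
Qed.

(** Every ratio used up to index [m] has numerator [i - s < 0], so the signs alternate. *)
Lemma bincoef_sign_initial (s : R) (m : nat) : 0 < s -> INR m < s + 1 ->
  0 < (-1) ^ m * bincoef s m.
Proof.
intros Hs; induction m as [|m IH]; intros Hm; [simpl; lra |].
rewrite S_INR in Hm; pose proof (pos_INR m).
cbn [bincoef pow].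
replace (_ * _) with ((-1) ^ m * bincoef s m * ((s - INR m) / (INR m + 1)))
  by (field; lra).
apply Rmult_lt_0_compat; [apply IH; lra | apply Rdiv_lt_0_compat; lra].
Qed.

Fixpoint binsum (s : R) (j : nat) (l : list Z) : R :=
  match l with
  | nil => 0
  | z :: l' => bincoef s j * (IZR z / 9 ^ j) + binsum s (S j) l'
  end.

Lemma binsum_skipn_zeros (s : R) (j i : nat) (l : list Z) : (i <= length l)%nat ->
  forallb (Z.eqb 0) (firstn i l) = true -> binsum s j l = binsum s (j + i) (skipn i l).
Proof.
revert j l; induction i as [|i IH]; intros j l Hl H; [rewrite Nat.add_0_r; reflexivity |].
destruct l as [|z l]; [simpl in Hl; lia |].
simpl in H; destruct z; try discriminate.
simpl in Hl; cbn [skipn binsum]; rewrite (IH (S j)) by (exact H || lia).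
replace (S j + i)%nat with (j + S i)%nat by lia; unfold Rdiv; ring.
Qed.

(** Soundness of the Horner scheme. The factor [b], later [bincoef s (k + 2)], makes all weights
    positive, and [T] stands for the scaled remainder of the truncated series. *)
Lemma horner_low_le (s b : R) (k j : nat) (l : list Z) (T : R) :
  (0 < k)%nat -> INR k < s < INR k + 1 -> (k + 2 <= j)%nat ->
  (forall i, (k + 2 <= i)%nat -> 0 < b * bincoef s i) ->
  - (b * bincoef s (j + length l) * INR (j + length l) / s) <= T ->
  b * bincoef s j * (IZR (horner_low (Z.of_nat k) (Z.of_nat j) l) / 9 ^ j)
    <= b * binsum s j l + T.
Proof.
intros Hk Hs Hj Hb; revert j Hj; induction l as [|z l IH]; intros j Hj HT;
  pose proof (Hb j Hj) as HB; assert (H9 : 0 < 9 ^ j) by (apply pow_lt; lra);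
  pose proof (lt_0_INR k Hk) as Hk0; pose proof (le_INR _ _ Hj) as HjR;
  rewrite plus_INR in HjR; simpl (INR 2) in HjR.
- cbn [length horner_low binsum] in *; rewrite Nat.add_0_r in HT.
  rewrite Rmult_0_r, Rplus_0_l; apply Rle_trans with (2 := HT).
  (* Rounding down and replacing [1/s] by the larger [1/k] both lower this negative term. *)
  pose proof (IZR_div_le (- (9 ^ Z.of_nat j * Z.of_nat j)) (Z.of_nat k) ltac:(lia)) as Hq.
  rewrite opp_IZR, mult_IZR, <- pow_IZR, <- !INR_IZR_INZ in Hq.
  set (q := IZR (_ / _)) in *.
  replace (- _) with (b * bincoef s j * (- (9 ^ j * INR j) / s / 9 ^ j)) by (field; lra).
  apply Rmult_le_compat_l; [lra |]; apply Rmult_le_compat_r; [left; apply Rinv_0_lt_compat, H9 |].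
  apply Rle_trans with (1 := Hq).
  unfold Rdiv; rewrite <- !Ropp_mult_distr_l; apply Ropp_le_contravar.
  apply Rmult_le_compat_l; [apply Rmult_le_pos; lra | apply Rinv_le_contravar; lra].
- cbn [length horner_low binsum] in *.
  specialize (IH (S j) ltac:(lia)).
  rewrite Nat.add_succ_r in HT; rewrite Nat.add_succ_l in IH; specialize (IH HT).
  replace (Z.of_nat (S j)) with (Z.of_nat j + 1)%Z in IH by lia.
  set (L := horner_low (Z.of_nat k) (Z.of_nat j + 1) l) in *; cbv zeta.
  set (d := (if (0 <=? L)%Z then 1 else 0)%Z).
  pose proof (IZR_div_le (L * (Z.of_nat j - Z.of_nat k - d)) (9 * (Z.of_nat j + 1))
    ltac:(lia)) as Hq.
  rewrite !mult_IZR, !minus_IZR, !plus_IZR, <- !INR_IZR_INZ in Hq.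
  set (q := (_ / (9 * (Z.of_nat j + 1)))%Z) in *.
  (* The unknown [s] is replaced by the endpoint of [[k, k + 1]] that is worse for the sign of [L]:
     [k + 1] if [L >= 0], and [k] otherwise. *)
  assert (HL : IZR L * (INR j - INR k - IZR d) <= IZR L * (INR j - s)).
  { unfold d; destruct (Z.leb_spec 0 L) as [HL | HL].
    - apply IZR_le in HL; apply Rmult_le_compat_l; lra.
    - apply IZR_lt in HL; apply Rmult_le_compat_neg_l; lra. }
  assert (Hq' : IZR q <= IZR L * (INR j - s) / (9 * (INR j + 1))).
  { apply Rle_trans with (1 := Hq); apply Rmult_le_compat_r; [| exact HL].
    left; apply Rinv_0_lt_compat; lra. }
  apply Rle_trans with (b * bincoef s j
    * ((IZR z + IZR L * (INR j - s) / (9 * (INR j + 1))) / 9 ^ j)).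
  + rewrite plus_IZR; apply Rmult_le_compat_l; [lra |].
    apply Rmult_le_compat_r; [left; apply Rinv_0_lt_compat, H9 | lra].
  + cbn [bincoef pow] in IH.
    apply Rle_trans with (b * (bincoef s j * (IZR z / 9 ^ j))
      + b * (bincoef s j * (INR j - s) / (INR j + 1)) * (IZR L / (9 * 9 ^ j))); [| lra].
    right; field; lra.
Qed.

(** * * Integrating the binomial expansion *)

(** Multiplied by the first omitted coefficient, both remainders lie in one interval [[0, r]]. Their
    difference is therefore at least [-r], and the error is paid once instead of twice. *)
Lemma rpow_integral_remainder (s W : R) (M : nat) (t t' : R -> R) :
  0 < s -> (forall x, 0 <= t x <= 1) -> (forall x, 0 <= t' x <= 1) ->
  ex_RInt (fun x => rpow (1 - t x) s) 0 1 ->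
  ex_RInt (fun x => rpow (1 - t' x) s) 0 1 ->
  is_RInt (fun x => binpoly s (S M) (t x) - binpoly s (S M) (t' x)) 0 1 W ->
  - (bincoef s (S M) ^ 2 * INR (S M) / s) <= bincoef s (S M) *
    (RInt (fun x => rpow (1 - t x) s) 0 1 - RInt (fun x => rpow (1 - t' x) s) 0 1 - W).
Proof.
intros Hs Ht Ht' E E' HW.
set (b := bincoef s (S M)); set (r := b ^ 2 * INR (S M) / s).
apply (RInt_correct (V := R_CompleteNormedModule)) in E, E'.
pose proof (is_RInt_minus (V := R_NormedModule) _ _ _ _ _ _ E E') as H1.
pose proof (is_RInt_minus (V := R_NormedModule) _ _ _ _ _ _ H1 HW) as H2.
pose proof (is_RInt_scal (V := R_NormedModule) _ _ _ b _ H2) as H3.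
pose proof (is_RInt_const (V := R_NormedModule) 0 1 (- r)) as H4.
replace (- r) with (scal (1 - 0) (- r)) by (unfold scal; simpl; unfold mult; simpl; ring).
apply (is_RInt_le _ _ _ _ _ _ Rle_0_1 H4 H3); intros x _.
pose proof (binpoly_remainder s M (t x) Hs (Ht x)) as B.
pose proof (binpoly_remainder s M (t' x) Hs (Ht' x)) as B'.
unfold scal, minus, plus, opp; simpl; unfold mult; simpl.
fold b in B, B'; fold r in B, B'; cbn [binpoly] in *; lra.
Qed.

(** The recursion peels off the lowest power first, the order in which [moment_diffs] produces its
    entries, whereas [binpoly] peels off the highest. *)
Fixpoint bintail (s : R) (j n : nat) (t : R) : R :=
  match n with
  | O => 0
  | S n' => bincoef s j * t ^ j + bintail s (S j) n' t
  end.

Lemma bintail_rev (s : R) (j n : nat) (t : R) :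
  bintail s j (S n) t = bintail s j n t + bincoef s (j + n) * t ^ (j + n).
Proof.
revert j; induction n as [|n IH]; intros j.
- rewrite Nat.add_0_r; cbn [bintail]; ring.
- change (bintail s j (S (S n)) t) with (bincoef s j * t ^ j + bintail s (S j) (S n) t).
  rewrite IH, Nat.add_succ_r, Nat.add_succ_l; cbn [bintail]; ring.
Qed.

Lemma bintail_binpoly (s : R) (n : nat) (t : R) : bintail s 0 n t = binpoly s n t.
Proof.
induction n as [|n IH]; [reflexivity | rewrite bintail_rev, IH; reflexivity].
Qed.

Definition comod (eps : Z) (k : nat) (x : R) : R := 1 - sqmod eps (Z.of_nat k) x / 9.

(** The two hypotheses are the loop invariant: one [comod_mul] raises the power [j] by one and
    lowers the starting exponent by [k + 2]. *)
Lemma is_RInt_moment_diffs (s : R) (eps : Z) (k n j : nat) (l l' : list Z) (off : Z) :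
  (forall x, cosum l off x = (9 * comod eps k x) ^ j) ->
  (forall x, cosum l' off x = (9 * comod (- eps) k x) ^ j) ->
  is_RInt (fun x => bintail s j n (comod eps k x) - bintail s j n (comod (- eps) k x)) 0 1
    (binsum s j (moment_diffs eps k n l l' off)).
Proof.
revert j l l' off; induction n as [|n IH]; intros j l l' off H H'.
- cbn [bintail moment_diffs binsum].
  apply is_RInt_ext with (fun _ => 0); [intros; symmetry; apply Rminus_diag |].
  replace 0 with (scal (1 - 0) 0) at 2 by (unfold scal; simpl; unfold mult; simpl; ring).
  apply (is_RInt_const (V := R_NormedModule)).
- cbn [bintail moment_diffs binsum].
  specialize (IH (S j) (comod_mul eps k l) (comod_mul (- eps) k l') (off - (Z.of_nat k + 2))%Z).
  apply is_RInt_ext with (fun x => plus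
    (scal (bincoef s j / 9 ^ j) (minus (cosum l off x) (cosum l' off x)))
    (bintail s (S j) n (comod eps k x) - bintail s (S j) n (comod (- eps) k x))).
  + intros x _; rewrite H, H', !Rpow_mult_distr.
    unfold plus, scal, minus, plus, opp; simpl; unfold mult; simpl.
    field; apply pow_nonzero; lra.
  + replace (bincoef s j * (IZR (const_coef l off - const_coef l' off) / 9 ^ j))
      with (scal (bincoef s j / 9 ^ j)
        (minus (IZR (const_coef l off)) (IZR (const_coef l' off))))
      by (rewrite minus_IZR; unfold scal, minus, plus, opp; simpl; unfold mult; simpl;
          field; apply pow_nonzero; lra).
    apply (is_RInt_plus (V := R_NormedModule)).
    * apply (is_RInt_scal (V := R_NormedModule)), (is_RInt_minus (V := R_NormedModule));
        apply is_RInt_cosum.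
    * apply IH; intros x; rewrite cosum_comod_mul, ?H, ?H'; unfold comod; simpl; field.
Qed.

(** * * The trinomials [P k] and [Q k] *)

Lemma Cmod_sq (z : C) : Cmod z ^ 2 = fst z ^ 2 + snd z ^ 2.
Proof.
unfold Cmod; rewrite pow2_sqrt; [reflexivity |].
pose proof (pow2_ge_0 (fst z)); pose proof (pow2_ge_0 (snd z)); lra.
Qed.

Definition trinomial (eps : Z) (k : nat) (x : R) : C :=
  (1 + e 1 x + RtoC (IZR eps) * e (Z.of_nat k + 2) x)%C.

Lemma trinomial_P (k : nat) (x : R) : trinomial 1 k x = P (Z.of_nat k) x.
Proof. unfold trinomial, P; ring. Qed.

Lemma trinomial_Q (k : nat) (x : R) : trinomial (-1) k x = Q (Z.of_nat k) x.
Proof.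
unfold trinomial, Q; replace (RtoC (IZR (-1))) with (Copp 1); [ring |].
apply injective_projections; simpl; ring.
Qed.

Lemma Cmod_trinomial_sq (eps : Z) (k : nat) (x : R) : eps = 1%Z \/ eps = (-1)%Z ->
  Cmod (trinomial eps k x) ^ 2 = sqmod eps (Z.of_nat k) x.
Proof.
intros He; unfold trinomial; rewrite Cmod_sq, !e_cos_sin; unfold sqmod.
set (a := 2 * PI * IZR 1 * x); set (c := 2 * PI * IZR (Z.of_nat k + 2) * x).
replace (2 * PI * IZR (Z.of_nat k + 1) * x) with (c - a)
  by (unfold a, c; rewrite !plus_IZR; ring).
rewrite cos_minus; cbn.
pose proof (sin2_cos2 a) as Ha; pose proof (sin2_cos2 c) as Hc; unfold Rsqr in *.
assert (E2 : IZR eps * IZR eps = 1) by (destruct He; subst eps; simpl; ring).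
transitivity (1 + 2 * cos a + (sin a * sin a + cos a * cos a)
  + IZR eps * IZR eps * (sin c * sin c + cos c * cos c)
  + IZR eps * (2 * (cos c * cos a + sin c * sin a) + 2 * cos c)); [ring |].
rewrite Ha, Hc, E2; ring.
Qed.

Lemma comod_bounds (eps : Z) (k : nat) (x : R) : eps = 1%Z \/ eps = (-1)%Z ->
  0 <= comod eps k x <= 1.
Proof.
intros He; pose proof (pow2_ge_0 (Cmod (trinomial eps k x))) as H0.
rewrite Cmod_trinomial_sq in H0 by exact He.
unfold comod; split; [| lra].
unfold sqmod in *; destruct He; subst eps; simpl in *;
  match goal with |- context [3 + 2 * cos ?u + _ * (2 * cos ?v + 2 * cos ?w)] =>
    pose proof (COS_bound u); pose proof (COS_bound v); pose proof (COS_bound w) end; lra.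
Qed.

Lemma rpow_comod (eps : Z) (k : nat) (p x : R) : eps = 1%Z \/ eps = (-1)%Z ->
  rpow (1 - comod eps k x) (p / 2)
  = / Rpower 9 (p / 2) * rpow (Cmod (trinomial eps k x)) p.
Proof.
intros He; pose proof (Cmod_trinomial_sq eps k x He) as E.
pose proof (Cmod_ge_0 (trinomial eps k x)) as H0.
set (m := Cmod (trinomial eps k x)) in *.
replace (1 - comod eps k x) with (m ^ 2 / 9) by (unfold comod; rewrite <- E; field).
destruct H0 as [H0 | <-].
- rewrite !rpow_pos_eq by nra.
  unfold Rpower; rewrite ln_div by nra; rewrite <- exp_Ropp, <- exp_plus; f_equal.
  simpl; rewrite Rmult_1_r, ln_mult by lra; field.
- replace (0 ^ 2 / 9) with 0 by field; rewrite !rpow_0; ring.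
Qed.

Lemma ex_RInt_trinomial (eps : Z) (k : nat) (p : R) : 0 < p ->
  eps = 1%Z \/ eps = (-1)%Z ->
  ex_RInt (fun x => rpow (Cmod (trinomial eps k x)) p) 0 1.
Proof.
intros Hp [-> | ->].
- apply ex_RInt_ext with (2 := ex_RInt_P p (Z.of_nat k) Hp).
  intros x _; rewrite trinomial_P; reflexivity.
- apply ex_RInt_ext with (2 := ex_RInt_Q p (Z.of_nat k) Hp).
  intros x _; rewrite trinomial_Q; reflexivity.
Qed.

(** * * Soundness of the certificate *)

Lemma length_moment_diffs (eps : Z) (k n : nat) (l l' : list Z) (off : Z) :
  length (moment_diffs eps k n l l' off) = n.
Proof.
revert l l' off; induction n as [|n IH]; intros; simpl; [| rewrite IH]; reflexivity.
Qed.

Lemma certificate_sound (eps : Z) (k n : nat) (p : R) :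
  eps = 1%Z \/ eps = (-1)%Z -> (0 < k)%nat -> INR k < p / 2 < INR k + 1 ->
  certificate eps k (k + 2 + S n) = true ->
  0 < bincoef (p / 2) (k + 2) *
    (RInt (fun x => rpow (Cmod (trinomial eps k x)) p) 0 1
     - RInt (fun x => rpow (Cmod (trinomial (- eps) k x)) p) 0 1).
Proof.
intros He Hk Hp Hcert.
assert (He' : (- eps = 1 \/ - eps = -1)%Z) by lia.
pose proof (pos_INR k) as Hk0; set (s := p / 2) in *.
assert (Hp0 : 0 < p) by (unfold s in Hp; lra).
pose proof (ex_RInt_trinomial eps k p Hp0 He) as E.
pose proof (ex_RInt_trinomial (- eps) k p Hp0 He') as E'.
set (f := fun x => rpow (Cmod (trinomial eps k x)) p) in *.
set (f' := fun x => rpow (Cmod (trinomial (- eps) k x)) p) in *.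
assert (HI : RInt (fun x => rpow (1 - comod eps k x) s) 0 1
  = / Rpower 9 s * RInt f 0 1).
{ rewrite <- (RInt_scal (V := R_CompleteNormedModule)) by exact E.
  apply RInt_ext; intros x _; apply rpow_comod, He. }
assert (HI' : RInt (fun x => rpow (1 - comod (- eps) k x) s) 0 1
  = / Rpower 9 s * RInt f' 0 1).
{ rewrite <- (RInt_scal (V := R_CompleteNormedModule)) by exact E'.
  apply RInt_ext; intros x _; apply rpow_comod, He'. }
assert (HE : ex_RInt (fun x => rpow (1 - comod eps k x) s) 0 1).
{ apply ex_RInt_ext with (fun x => scal (/ Rpower 9 s) (f x)).
  - intros x _; symmetry; apply rpow_comod, He.
  - apply (ex_RInt_scal (V := R_NormedModule)), E. }
assert (HE' : ex_RInt (fun x => rpow (1 - comod (- eps) k x) s) 0 1).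
{ apply ex_RInt_ext with (fun x => scal (/ Rpower 9 s) (f' x)).
  - intros x _; symmetry; apply rpow_comod, He'.
  - apply (ex_RInt_scal (V := R_NormedModule)), E'. }
unfold certificate in Hcert; cbv zeta in Hcert.
apply andb_prop in Hcert; destruct Hcert as [Hz Hpos].
set (l := moment_diffs eps k (k + 2 + S n) (1%Z :: nil) (1%Z :: nil) 0) in *.
assert (Hlen : length l = (k + 2 + S n)%nat) by apply length_moment_diffs.
assert (Hone : forall x, cosum (1%Z :: nil) 0 x = 1)
  by (intros x; simpl; rewrite Rmult_0_r, Rmult_0_l, cos_0; ring).
pose proof (is_RInt_moment_diffs s eps k (k + 2 + S n) 0 (1%Z :: nil) (1%Z :: nil) 0 Hone Hone)
  as HW; fold l in HW.
apply (is_RInt_ext _ (fun x => binpoly s (k + 2 + S n) (comod eps k x)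
  - binpoly s (k + 2 + S n) (comod (- eps) k x))) in HW;
  [| intros x _; rewrite !bintail_binpoly; reflexivity].
rewrite (binsum_skipn_zeros s 0 (k + 2) l) in HW by (exact Hz || lia).
rewrite Nat.add_0_l in HW; set (r := skipn (k + 2) l) in *.
assert (Hr : length r = S n) by (unfold r; rewrite length_skipn; lia).
rewrite Nat.add_succ_r in HW.
apply rpow_integral_remainder in HW; try assumption;
  [| lra | intros; apply comod_bounds, He | intros; apply comod_bounds, He'].
rewrite HI, HI' in HW; rewrite <- Nat.add_succ_r in HW.
(* [bincoef s k] is nonzero, and the two further factors [k - s] and [k + 1 - s] do not vanish
   because [s] lies strictly between [k] and [k + 1]. *)
assert (Hb0 : bincoef s (k + 2) <> 0).
{ replace (k + 2)%nat with (S (S k)) by lia; cbn [bincoef]; rewrite S_INR.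
  pose proof (bincoef_sign_initial s k ltac:(lra) ltac:(lra)) as Hs0.
  unfold Rdiv; repeat apply Rmult_integral_contrapositive_currified;
    try apply Rinv_neq_0_compat; try lra.
  intros H0; rewrite H0 in Hs0; lra. }
assert (Hsign : forall i, (k + 2 <= i)%nat -> 0 < bincoef s (k + 2) * bincoef s i).
{ intros i Hi; replace i with (k + 2 + (i - (k + 2)))%nat by lia.
  apply bincoef_sign_past; [rewrite plus_INR; simpl; lra | exact Hb0]. }
set (b := bincoef s (k + 2)) in *.
set (N := (k + 2 + S n)%nat) in *.
set (X := _ - _ - binsum s (k + 2) r) in HW.
(* The remainder bound is normalised by the last coefficient [g]. As [b] and [g] have the same sign,
   multiplication by [b g / g^2 > 0] normalises it by [b] instead. *)
assert (HT : - (b * bincoef s (k + 2 + length r) * INR (k + 2 + length r) / s) <= b * X).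
{ rewrite Hr; fold N; pose proof (Hsign N ltac:(unfold N; lia)) as HN.
  set (g := bincoef s N) in *.
  assert (Hg : 0 < g ^ 2) by (apply pow2_gt_0; intros H0; rewrite H0 in HN; lra).
  replace (b * X) with (b * g / g ^ 2 * (g * X)) by (field; intros H0; rewrite H0 in HN; lra).
  replace (- _) with (b * g / g ^ 2 * - (g ^ 2 * INR N / s))
    by (field; split; [lra | intros H0; rewrite H0 in HN; lra]).
  apply Rmult_le_compat_l; [left; apply Rdiv_lt_0_compat; assumption | exact HW]. }
pose proof (horner_low_le s b k (k + 2) r (b * X) Hk Hp (le_n _) Hsign HT) as HH.
apply Z.ltb_lt, IZR_lt in Hpos.
assert (HD : 0 < b * (/ Rpower 9 s * (RInt f 0 1 - RInt f' 0 1))).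
{ replace (b * _) with (b * binsum s (k + 2) r + b * X) by (unfold X; ring).
  apply Rlt_le_trans with (2 := HH).
  apply Rmult_lt_0_compat; [apply Hsign; lia |].
  apply Rdiv_lt_0_compat; [exact Hpos | apply pow_lt; lra]. }
pose proof (exp_pos (s * ln 9)) as H9; change (exp (s * ln 9)) with (Rpower 9 s) in H9.
replace (b * _) with (Rpower 9 s * (b * (/ Rpower 9 s * (RInt f 0 1 - RInt f' 0 1))))
  by (field; lra).
apply Rmult_lt_0_compat; assumption.
Qed.

(** * * Comparison of the norms *)

Lemma pnorm_lt (p : R) (f g : R -> C) : 0 < p ->
  ex_RInt (fun x => rpow (Cmod (f x)) p) 0 1 ->
  RInt (fun x => rpow (Cmod (f x)) p) 0 1 < RInt (fun x => rpow (Cmod (g x)) p) 0 1 ->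
  pnorm p f < pnorm p g.
Proof.
intros Hp E H; unfold pnorm.
assert (H0 : 0 <= RInt (fun x => rpow (Cmod (f x)) p) 0 1).
{ apply RInt_ge_0; [lra | exact E |]; intros x _; unfold rpow.
  destruct (Req_EM_T _ 0); [lra | left; apply exp_pos]. }
pose proof (Rinv_0_lt_compat p Hp).
rewrite (rpow_pos_eq (RInt (fun x => rpow (Cmod (g x)) p) 0 1)) by lra.
destruct H0 as [H0 | <-].
- rewrite rpow_pos_eq by exact H0; apply Rlt_Rpower_l; lra.
- rewrite rpow_0; apply exp_pos.
Qed.

Theorem mainTheorem1 (k : Z) (p : R)
  (hk : k = 3%Z \/ k = 4%Z)
  (hp : 2 * IZR k < p < 2 * IZR k + 2) :
  pnorm p (P k) < pnorm p (Q k).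
Proof.
assert (Hp0 : 0 < p) by (destruct hk; subst k; lra).
apply pnorm_lt; [exact Hp0 | apply ex_RInt_P, Hp0 |].
assert (EP : forall m : nat, RInt (fun x => rpow (Cmod (trinomial 1 m x)) p) 0 1
  = RInt (fun x => rpow (Cmod (P (Z.of_nat m) x)) p) 0 1)
  by (intros m; apply RInt_ext; intros x _; rewrite trinomial_P; reflexivity).
assert (EQ : forall m : nat, RInt (fun x => rpow (Cmod (trinomial (-1) m x)) p) 0 1
  = RInt (fun x => rpow (Cmod (Q (Z.of_nat m) x)) p) 0 1)
  by (intros m; apply RInt_ext; intros x _; rewrite trinomial_Q; reflexivity).
destruct hk; subst k.
(* The 40 terms are [3 + 2 + S 34]. With [eps = -1] the difference is the integral for [Q 3] minus
   that for [P 3], and its factor [b_5] is positive. *)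
- pose proof (certificate_sound (-1) 3 34 p ltac:(lia) ltac:(lia) ltac:(simpl; lra)
    certificate_3) as H.
  change (- (-1))%Z with 1%Z in H; rewrite EP, EQ in H;
    cbn [Z.of_nat Pos.of_succ_nat Pos.succ] in H.
  pose proof (bincoef_sign_initial (p / 2) 4 ltac:(lra) ltac:(simpl; lra)) as Hb.
  assert (Hb5 : 0 < bincoef (p / 2) (3 + 2)).
  { change (bincoef (p / 2) (3 + 2)) with (bincoef (p / 2) 4 * (INR 4 - p / 2) / (INR 4 + 1)).
    simpl INR; simpl pow in Hb; apply Rdiv_lt_0_compat; [apply Rmult_lt_0_compat |]; lra. }
  nra.
(* The 46 terms are [4 + 2 + S 39]. Now the difference is [P 4] minus [Q 4], and its factor [b_6] is
   negative, so the inequality has the same direction as for [k = 3]. *)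
- pose proof (certificate_sound 1 4 39 p ltac:(lia) ltac:(lia) ltac:(simpl; lra)
    certificate_4) as H.
  change (- (1))%Z with (-1)%Z in H; rewrite EP, EQ in H;
    cbn [Z.of_nat Pos.of_succ_nat Pos.succ] in H.
  pose proof (bincoef_sign_initial (p / 2) 5 ltac:(lra) ltac:(simpl; lra)) as Hb.
  assert (Hb6 : 0 < - bincoef (p / 2) (4 + 2)).
  { change (bincoef (p / 2) (4 + 2)) with (bincoef (p / 2) 5 * (INR 5 - p / 2) / (INR 5 + 1)).
    simpl INR; simpl pow in Hb.
    replace (- _) with ((- bincoef (p / 2) 5) * (1 + 1 + 1 + 1 + 1 - p / 2) / (1 + 1 + 1 + 1 + 1 + 1))
      by (field; lra).
    apply Rdiv_lt_0_compat; [apply Rmult_lt_0_compat |]; lra. }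
  nra.
Qed.
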